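(* Let $X$ be a Urysohn almost discretely Lindelöf space. Then $|X| \leq 2^{\chi(X)}$.
   Context: All spaces are assumed to be $T_1$. A space $X$ is almost discretely Lindelöf if for every discrete subset $D \subset X$ (i.e. $D$ is discrete in the subspace topology) there is a Lindelöf subspace $L$ of $X$ such that $D \subset L$. ''Lindelöf'' means that every open cover has a countable subcover (no separation axiom is implied). A space $X$ is Urysohn if for every pair of distinct points $x,y \in X$ there are open neighbourhoods $U$ of $x$ and $V$ of $y$ such that $\overline{U} \cap \overline{V} = \emptyset$. $\chi(X)$ denotes the character of $X$, i.e. the least infinite cardinal $\kappa$ such that every point of $X$ has a neighbourhood base of cardinality at most $\kappa$. *)

(* Defs.v *)
From mathcomp Require Import all_boot all_classical topology.

Set Implicit Arguments.
Unset Strict Implicit.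
Unset Printing Implicit Defensive.

Local Open Scope classical_set_scope.
Local Open Scope card_scope.

Definition discrete_space (T : topologicalType) : Prop :=
  forall A : set T, open A.

Definition lindelof_space (T : topologicalType) : Prop :=
  forall U : set (set T), U `<=` open -> [set: T] `<=` cover U id ->
  exists V : set (set T), [/\ V `<=` U, countable V & [set: T] `<=` cover V id].

(* [set_type A] carries the subspace topology of [A]. *)
Definition almost_discretely_lindelof (X : topologicalType) : Prop :=
  forall D : set X, discrete_space (set_type D) ->
  exists L : set X, lindelof_space (set_type L) /\ D `<=` L.

Definition urysohn_space (X : topologicalType) : Prop :=
  forall x y : X, x <> y -> exists U V : set X,
  [/\ open_nbhs x U, open_nbhs y V & closure U `&` closure V = set0].

Definition nbhs_base (X : topologicalType) (x : X) (B : set (set X)) : Prop :=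
  B `<=` nbhs x /\ forall U, nbhs x U -> exists2 V, B V & V `<=` U.

(* A type [K] stands for the cardinal of [[set: K]]. *)
Definition character_bound (X : topologicalType) (K : Type) : Prop :=
  infinite_set [set: K] /\
  forall x : X, exists2 B, nbhs_base x B & B #<= [set: K].

Definition is_character (X : topologicalType) (K : Type) : Prop :=
  character_bound X K /\
  forall K' : Type, character_bound X K' -> [set: K] #<= [set: K'].

(* Any nonempty family of cardinals has a least element: take a maximal set of
   choice functions on which every projection is injective; some projection
   must then be onto. *)
Lemma card_le_min (I T : Type) (A : I -> set T) (i0 : I) :
  exists i, forall j, A i #<= A j.
Proof.
pose P (F : set (I -> T)) := (forall f, F f -> forall i, A i (f i)) /\
  (forall f g, F f -> F g -> forall i, f i = g i -> f = g).
have [|F [[FA Finj] Fmax]] := @Zorn_bigcup _ P.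
  move=> C CP Ctot; split.
    by move=> f [X CX Xf] i; have [+ _] := CP _ CX; apply.
  move=> f g [X CX Xf] [Y CY Yg] i fg.
  have [XY|YX] := Ctot _ _ CX CY.
    have [_ h] := CP _ CY; exact: (h f g (XY _ Xf) Yg i fg).
  have [_ h] := CP _ CX; exact: (h f g Xf (YX _ Yg) i fg).
have [i Hi] : exists i, forall a, A i a -> exists2 f, F f & f i = a.
  apply: contrapT => /forallNP H.
  have /choice[g gP] : forall i, exists a, A i a /\ ~ exists2 f, F f & f i = a.
    by move=> i; have /existsNP[a /not_implyP] := H i; exists a.
  apply: (Fmax (F `|` [set g])).
    split; first exact: subsetUl.
    by move=> /(_ g (or_intror erefl)) Fg; apply: (gP i0).2; exists g.
  split.
    by move=> f [/FA//|->] i; exact: (gP i).1.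
  move=> f h [Ff|->] [Fh|->] i fh //.
  - exact: Finj Ff Fh i fh.
  - by case: (gP i) => _ []; exists f.
  - by case: (gP i) => _ []; exists h.
exists i => j.
have /choice[s sP] : forall a, exists f : I -> T, A i a -> F f /\ f i = a.
  move=> a; have [Aa|nA] := pselect (A i a).
    by have [f Ff fa] := Hi _ Aa; exists f.
  by exists (fun=> a).
have /injfunPex[f] : $|{injfun A i >-> A j}|.
  apply/injfunPex; exists (fun a => s a j).
    by move=> a Aa; apply: FA; have [] := sP a Aa.
  move=> a b /set_mem Aa /set_mem Ab sab.
  have [Fa <-] := sP a Aa; have [Fb <-] := sP b Ab.
  by rewrite (Finj _ _ Fa Fb j sab).
move=> fAB finj; have [u] : $|{injfun A i >-> A j}| by apply/injfunPex; exists f.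
exact: inj_card_le u.
Qed.

Lemma card_le_total_type (T U : Type) :
  [set: T] #<= [set: U] \/ [set: U] #<= [set: T].
Proof.
pose A (b : bool) : set (T + U) := if b then range inl else range inr.
have ET : A true #= [set: T] by apply: inj_card_eq => x y _ _ [].
have EU : A false #= [set: U] by apply: inj_card_eq => x y _ _ [].
have [[] H] := card_le_min A true; [left|right].
  by have := H false; rewrite (card_le_eql ET) (card_le_eqr EU).
by have := H true; rewrite (card_le_eql EU) (card_le_eqr ET).
Qed.

Lemma is_character_exists (X : topologicalType) :
  exists K : Type, is_character X K.
Proof.
pose K0 := (set X + nat)%type.
have bound0 : character_bound X (set_type [set: K0]).
  split.
    have e : [set: set_type [set: K0]] #= [set: K0] := card_setT _.
    apply/infiniteP; rewrite (card_le_eqr e).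
    have i : range (@inr (set X) nat) #= [set: nat].
      by apply: inj_card_eq => x y _ _ [].
    rewrite -(card_le_eql i); exact: subset_card_le.
  move=> x; exists (nbhs x); first by split => // U xU; exists U.
  have e : [set: set_type [set: K0]] #= [set: K0] := card_setT _.
  rewrite (card_le_eqr e).
  have i : (@inl (set X) nat) @` nbhs x #= nbhs x.
    by apply: inj_card_eq => u v _ _ [].
  rewrite -(card_le_eql i); exact: subset_card_le.
pose Q (A : set K0) := character_bound X (set_type A).
have [[A bA] Amin] := @card_le_min {A | Q A} K0 (@sval _ _) (exist Q [set: K0] bound0).
have eA : [set: set_type A] #= A := card_setT _.
exists (set_type A); split => // K' bK'; rewrite (card_le_eql eA).
have [KK'|K'K] := card_le_total_type K0 K'.
  by apply: card_le_trans KK'; exact: subset_card_le.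
have /card_leP[f] := K'K.
have [g ginj] : exists g : K' -> K0, injective g.
  exists (fun k => val (f (to_setT k))) => x y /val_inj fxy.
  have := 'inj_f (mem_set I) (mem_set I) fxy.
  by move=> /(congr1 val).
have eg : [set: set_type (range g)] #= [set: K'].
  apply: card_eq_trans (card_setT _) _; apply: inj_card_eq => x y _ _; exact: ginj.
have bg : character_bound X (set_type (range g)).
  case: bK' => infK' baseK'; split.
    by apply/infiniteP; rewrite (card_le_eqr eg); apply/infiniteP.
  move=> x; have [B Bx BK'] := baseK' x.
  by exists B => //; rewrite (card_le_eqr eg).
have /= := Amin (exist Q (range g) bg); move/card_le_trans; apply.
exact: card_image_le.
Qed.

(* The cardinal of [character X] is the least infinite cardinal bounding the
   size of some neighbourhood base at each point; it is unique up to [#=]. *)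
Definition character (X : topologicalType) : Type :=
  sval (cid (is_character_exists X)).

Lemma characterP (X : topologicalType) : is_character X (character X).
Proof. exact: svalP. Qed.

(* Main.v *)
Require Import Defs.
From mathcomp Require Import all_boot all_classical topology.
From mathcomp Require wochoice.

(** Write kappa for the character of X and lambda for 2^kappa.

    The argument rests on a closing-off lemma, [closing_off], for a subspace Y
    in which discrete sets lie in Lindelof sets.  Suppose that each A of size
    at most kappa comes with lambda open sets containing its closure in Y,
    such that all but lambda many points of Y are missed by one of them
    ([separates]).  Then Y has at most lambda points.  Indeed, let H be a set
    of size lambda closed under two operations: adding the exceptional points
    of each A in H of size kappa, and adding a point outside any union of
    kappa of the chosen open sets that does not cover Y.  If p were outside H,
    one could choose x_w in H and open sets O_w missing p, for w below
    kappa^+, with O_w containing the closure of the x_v, v < w, and x_w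
    outside all O_u, u <= w: the O_u, u <= w, miss p, so do not cover Y, and
    H must then contain a point outside them.  Each O_w separates the x_v,
    v < w, from the later terms, so the x_w form a discrete set and lie in a
    Lindelof set L.  As the character is kappa, every point of L in the
    closure of the sequence is in the closure of an initial segment, so L is
    covered by the O_w and the complement of the closure of the sequence.
    Countably many of these suffice, yet they miss a tail of the sequence.

    The lemma is used twice.  For Y Lindelof the open sets are countable
    unions of basic ones, so Lindelof subspaces, and with them all discrete
    subsets, have at most lambda points ([lindelof_covers]).  For Y = X let C
    be the closure of A.  A point y outside the theta-closure S of C has an
    open neighbourhood B y whose closure misses C.  Shapirovskii's lemma
    ([discrete_cover]) gives a discrete set E such that the closure of E and
    the B y with y in E cover the complement of S.  Now E has at most lambda
    points, hence so does its closure, and the complements of the closures of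
    the B y, for y in the closure of E but outside S, are the required open
    sets.  The Urysohn property enters through [theta_closure_covers]: it
    keeps theta-closures of sets of size lambda at size lambda.

    Cardinal arithmetic is reduced to the existence of injections.  The set H
    is the set of values of well-founded kappa-branching trees, and kappa^+ is
    a well-order whose initial segments have size at most kappa. *)

Set Implicit Arguments.
Unset Strict Implicit.
Unset Printing Implicit Defensive.

Local Open Scope classical_set_scope.

(** * The square of an infinite cardinal *)

Lemma card_le_injP T U :
  ([set: T] #<= [set: U])%card <-> exists f : T -> U, injective f.
Proof.
split=> [/card_leP[f]|[f fI]].
  exists (fun x => val (f (to_setT x))) => x y /val_inj.
  by move=> /'inj_f => /(_ (mem_set I) (mem_set I))/(congr1 val).
by apply: inj_card_le; apply: unsquash; apply/injfunPex; exists f => // x y _ _ /fI.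
Qed.

(** A partial pairing function is kept as its graph, a set of triples, so that
    unions of chains are again graphs; its domain is the square of [support]. *)
Definition support K (G : set (K * K * K)) : set K :=
  [set x | exists z, G (x, x, z)].

Definition pairing_graph K (G : set (K * K * K)) : Prop :=
  [/\ forall p z z', G (p, z) -> G (p, z') -> z = z',
      forall p p' z, G (p, z) -> G (p', z) -> p = p',
      forall x y z, G (x, y, z) -> [/\ support G x, support G y & support G z] &
      forall x y, support G x -> support G y -> exists z, G (x, y, z)].

Lemma pairing_graph_bigcup K (F : set (set (K * K * K))) :
  F `<=` @pairing_graph K -> total_on F subset ->
  pairing_graph (\bigcup_(G in F) G).
Proof.
move=> Fp Ft.
have dir G G' : F G -> F G' -> exists H, [/\ F H, G `<=` H & G' `<=` H].
  by move=> FG FG'; have [GG'|G'G] := Ft _ _ FG FG'; [exists G'|exists G]; split.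
have supp G x : F G -> support G x -> support (\bigcup_(G in F) G) x.
  by move=> FG [z Gz]; exists z; exists G.
split.
- move=> p z z' [G FG Gz] [G' FG' Gz'].
  have [H [FH GH GH']] := dir _ _ FG FG'.
  by have [h _ _ _] := Fp _ FH; exact: h (GH _ Gz) (GH' _ Gz').
- move=> p p' z [G FG Gz] [G' FG' Gz'].
  have [H [FH GH GH']] := dir _ _ FG FG'.
  by have [_ h _ _] := Fp _ FH; exact: h (GH _ Gz) (GH' _ Gz').
- move=> x y z [G FG Gz].
  by have [_ _ /(_ _ _ _ Gz)[? ? ?] _] := Fp _ FG; split; exact: supp FG _.
- move=> x y [z [G FG Gz]] [z' [G' FG' Gz']].
  have [H [FH GH GH']] := dir _ _ FG FG'.
  have [_ _ _ /(_ x y)] := Fp _ FH.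
  case; [by exists z; exact: GH|by exists z'; exact: GH'|].
  by move=> t Ht; exists t, H.
Qed.

(** The starting point for Zorn's lemma: beginning with an infinite support
    excludes the maximal pairing functions on one point. *)
Lemma pairing_graph_nat K : infinite_set [set: K] ->
  exists2 G : set (K * K * K), pairing_graph G &
    exists c : nat -> K, injective c /\ forall i, support G (c i).
Proof.
move=> /infiniteP/card_le_injP[c cI].
have [q qI] : exists q : nat * nat -> nat, injective q.
  by exists pickle; exact: (pcan_inj pickleK).
pose G : set (K * K * K) := [set t | exists i j, t = (c i, c j, c (q (i, j)))].
have sG i : support G (c i) by exists (c (q (i, i))), i, i.
have sG' x : support G x -> exists i, x = c i by move=> [z [i [j [-> _ _]]]]; exists i.
exists G; last by exists c.
split.
- by move=> p z z' [i [j [-> ->]]] [i' [j' [/cI<- /cI<- ->]]].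
- by move=> p p' z [i [j [-> ->]]] [i' [j' [-> /cI/qI[-> ->]]]].
- by move=> x y z [i [j [-> -> ->]]]; split.
- by move=> _ _ /sG'[i ->] /sG'[j ->]; exists (c (q (i, j))), i, j.
Qed.

(** Hessenberg's theorem.  Let [G] be maximal with support [A].  If the
    complement of [A] injects into [A], two disjoint copies of [A] inside [A]
    absorb the whole type, and [G] pairs it.  Otherwise a disjoint copy of [A]
    fits outside [A], and three copies of the square of [A], paired into that
    copy, extend [G]. *)
Theorem infinite_pairing K : infinite_set [set: K] ->
  exists f : K * K -> K, injective f.
Proof.
move=> /[dup] Kinf /pairing_graph_nat[G0 pG0 [c [cI G0c]]].
pose P (G : set (K * K * K)) := pairing_graph (G `|` G0).
(* Adding [G0] to every member keeps it inside the maximal graph, also when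
   Zorn's lemma takes the union of the empty chain. *)
have [|G1 [PG1 G1max]] := @Zorn_bigcup _ P.
  move=> F FP Ft; rewrite /P.
  have -> : \bigcup_(G in F) G `|` G0 =
      \bigcup_(G in [set G0] `|` [set G `|` G0 | G in F]) G.
    apply/seteqP; split=> t.
      move=> [[G FG Gt]|G0t]; last by exists G0; [left|].
      by exists (G `|` G0); [right; exists G|left].
    by move=> [_ [->|[G FG <-]]]; [right|move=> [?|?]; [left; exists G|right]].
  apply: pairing_graph_bigcup; first by move=> _ [->|[G /FP ? <-]].
  move=> _ _ [->|[G FG <-]] [->|[G' FG' <-]].
  - by left.
  - by left=> t; right.
  - by right=> t; right.
  - by have [GG|GG] := Ft _ _ FG FG'; [left|right]; apply: setSU.
pose G := G1 `|` G0.
have Gmax G' : G `<=` G' -> pairing_graph G' -> G' `<=` G.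
  move=> GG' pG' t G't; apply: contrapT => nGt; apply: (G1max G').
    split; first by move=> u G1u; apply: GG'; left.
    by move=> /(_ _ G't) G1t; apply: nGt; left.
  rewrite /P; suff -> : G' `|` G0 = G' by [].
  by apply/seteqP; split=> [u [//|?]|u ?]; [apply: GG'; right|left].
pose A := support G.
have Ac i : A (c i) by have [z ?] := G0c i; exists z; right.
have [Gfun Ginj Gsupp Gdom] : pairing_graph G := PG1.
have /choice[f fP] : forall p : K * K, exists z, A p.1 -> A p.2 -> G (p, z).
  move=> [x y]; have [[Ax Ay]|nA] := pselect (A x /\ A y).
    by have [z Gz] := Gdom x y Ax Ay; exists z.
  by exists x => ? ?; case: nA.
have fA x y : A x -> A y -> A (f (x, y)).
  by move=> Ax Ay; have [] := Gsupp _ _ _ (fP (x, y) Ax Ay).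
have fI x y x' y' : A x -> A y -> A x' -> A y' -> f (x, y) = f (x', y') ->
    x = x' /\ y = y'.
  move=> Ax Ay Ax' Ay' ff; have := fP (x', y') Ax' Ay'; rewrite -ff.
  by move=> /(Ginj _ _ _ (fP (x, y) Ax Ay))[].
have [AC|AC] := card_le_total_type (set_type (~` A)) (set_type A).
  have [h hI] := (card_le_injP _ _).1 AC.
  have [j jA jI] : exists2 j : K -> K, (forall x, A (j x)) & injective j.
    exists (fun x => match pselect (A x) with
      | left _ => f (c 0, x)
      | right nA => f (c 1, val (h (exist _ x (mem_set nA))))
      end).
      by move=> x; case: pselect => Ax; apply: fA => //; exact: set_valP.
    move=> x y; case: pselect => Ax; case: pselect => Ay.
    - by move=> /(fI _ _ _ _ (Ac 0) Ax (Ac 0) Ay)[].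
    - by move=> /(fI _ _ _ _ (Ac 0) Ax (Ac 1) (set_valP _))[/cI].
    - by move=> /(fI _ _ _ _ (Ac 1) (set_valP _) (Ac 0) Ay)[/cI].
    - move=> /(fI _ _ _ _ (Ac 1) (set_valP _) (Ac 1) (set_valP _))[_].
      by move=> /val_inj/hI[].
  exists (fun p => f (j p.1, j p.2)) => -[x y] [x' y'] /=.
  by move=> /(fI _ _ _ _ (jA _) (jA _) (jA _) (jA _))[/jI-> /jI->].
exfalso.
have [h' h'I] := (card_le_injP _ _).1 AC.
have [h hA hI] : exists2 h : K -> K, (forall x, A x -> ~ A (h x)) &
    (forall x y, A x -> A y -> h x = h y -> x = y).
  exists (fun x => match pselect (A x) with
      | left Ax => val (h' (exist _ x (mem_set Ax))) | right _ => x end).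
    by move=> x Ax; case: pselect => // ?; exact (set_valP (h' _)).
  move=> x y Ax Ay; case: pselect => // ?; case: pselect => // ?.
  by move=> /val_inj/h'I[].
(* [z i x y], for [i] = 0, 1, 2, lies in the copy [h @` A] and encodes the
   new pairs (x, h y), (h x, y) and (h x, h y). *)
pose z i x y := h (f (c i, f (x, y))).
pose G' := G `|` [set t | exists x y, [/\ A x, A y &
  [\/ t = (x, h y, z 0 x y), t = (h x, y, z 1 x y) | t = (h x, h y, z 2 x y)]]].
have zI i j x y x' y' : A x -> A y -> A x' -> A y' -> z i x y = z j x' y' ->
    [/\ i = j, x = x' & y = y'].
  move=> Ax Ay Ax' Ay' /hI zz; have {zz} := zz (fA _ _ (Ac i) (fA _ _ Ax Ay)).
  move=> /(_ (fA _ _ (Ac j) (fA _ _ Ax' Ay'))).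
  move=> /(fI _ _ _ _ (Ac i) (fA _ _ Ax Ay) (Ac j) (fA _ _ Ax' Ay'))[/cI->].
  by move=> /(fI _ _ _ _ Ax Ay Ax' Ay')[].
have sG' x : support G' x -> A x \/ exists2 y, A y & x = h y.
  move=> [t [Gt|]]; first by left; exists t.
  move=> [y [y' [Ay Ay' [[-> _]|[-> _]|[-> _]]]]]; first by left.
    by right; exists y.
  by right; exists y.
have sA x : A x -> support G' x by move=> [t ?]; exists t; left.
have sh x : A x -> support G' (h x).
  by move=> Ax; exists (z 2 x x); right; exists x, x; split => //; constructor 3.
have szA i x y : A x -> A y -> A (f (c i, f (x, y))).
  by move=> Ax Ay; exact: fA (Ac i) (fA _ _ Ax Ay).
suff pG' : pairing_graph G'.
  have /(Gmax _ (@subsetUl _ _ _) pG') /Gsupp[_ /(hA _ (Ac 0))[]] :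
      G' (c 0, h (c 0), z 0 (c 0) (c 0)).
  by right; exists (c 0), (c 0); split => //; constructor 1.
split.
- move=> p t t' [Gt|[x [y [Ax Ay E]]]] [Gt'|[x' [y' [Ax' Ay' E']]]].
  + exact: Gfun Gt Gt'.
  + case: E' Gt => -[-> _] /Gsupp[]; have := hA _ Ax'; have := hA _ Ay'; by [].
  + case: E Gt' => -[-> _] /Gsupp[]; have := hA _ Ax; have := hA _ Ay; by [].
  + have hx := hA _ Ax; have hy := hA _ Ay; have hx' := hA _ Ax'; have hy' := hA _ Ay'.
    case: p E E' => u v [] [-> -> ->] [] [E1 E2 ->].
    * by rewrite E1 (hI _ _ Ay Ay' E2).
    * by case: hx'; rewrite -E1.
    * by case: hx'; rewrite -E1.
    * by case: hx; rewrite E1.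
    * by rewrite E2 (hI _ _ Ax Ax' E1).
    * by case: hy'; rewrite -E2.
    * by case: hx; rewrite E1.
    * by case: hy; rewrite E2.
    * by rewrite (hI _ _ Ax Ax' E1) (hI _ _ Ay Ay' E2).
- move=> p p' t [Gt|[x [y [Ax Ay E]]]] [Gt'|[x' [y' [Ax' Ay' E']]]].
  + exact: Ginj Gt Gt'.
  + by case: p Gt => ? ? /Gsupp[_ _]; case: E' => -[_ ->] /(hA _ (szA _ _ _ Ax' Ay')).
  + by case: p' Gt' => ? ? /Gsupp[_ _]; case: E => -[_ ->] /(hA _ (szA _ _ _ Ax Ay)).
  + by case: E E' => [] [-> ->] [] [-> /(zI _ _ _ _ _ _ Ax Ay Ax' Ay')[ij -> ->]].
- move=> x y t [/Gsupp[? ? ?]|[x' [y' [Ax Ay E]]]]; first by split; exact: sA.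
  by case: E => -[-> -> ->]; split; by [exact: sA|exact: sh|apply: sh; exact: szA].
- move=> x y /sG' + /sG'; move=> [Ax|[x' Ax ->]] [Ay|[y' Ay ->]].
  + by have [t Gt] := Gdom x y Ax Ay; exists t; left.
  + by exists (z 0 x y'); right; exists x, y'; split => //; constructor 1.
  + by exists (z 1 x' y); right; exists x', y; split => //; constructor 2.
  + by exists (z 2 x' y'); right; exists x', y'; split => //; constructor 3.
Qed.

(** * Comparing sizes by injections and enumerations *)

Definition embeds T U := exists f : T -> U, injective f.

(** Sizes of sets of points are bounded by enumerations rather than by
    injections, because the closing-off construction indexes by them. *)
Definition covers P X (A : set X) := exists f : P -> X, A `<=` range f.

Lemma embeds_refl T : embeds T T.
Proof. by exists id. Qed.

Lemma embeds_trans T U V : embeds T U -> embeds U V -> embeds T V.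
Proof. by move=> [f fI] [g gI]; exists (g \o f); exact: inj_comp. Qed.

Lemma embeds_set T U : embeds T U -> embeds (set T) (set U).
Proof.
move=> [f fI]; exists (fun A => f @` A) => A B /seteqP[AB BA].
apply/seteqP; split=> x Ax.
  by have [|y By /fI <-] := AB (f x); first by exists x.
by have [|y By /fI <-] := BA (f x); first by exists x.
Qed.

Lemma embeds_prod T U T' U' :
  embeds T U -> embeds T' U' -> embeds (T * T') (U * U').
Proof.
move=> [f fI] [g gI]; exists (fun p => (f p.1, g p.2)).
by move=> [x y] [x' y'] /= [/fI-> /gI->].
Qed.

Lemma embeds_fun I T K : embeds T (set K) -> embeds (I -> T) (set (I * K)).
Proof.
move=> [g gI]; exists (fun f => [set p | g (f p.1) p.2]) => f f' /seteqP[h h'].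
apply/funext => i; apply: gI; apply/seteqP.
by split=> k; [exact: (h (i, k))|exact: (h' (i, k))].
Qed.

(** The tag added to the image of a set tells the two summands apart, also for
    the empty set. *)
Lemma embeds_sum T U V K :
  embeds T (set V) -> embeds U (set V) -> embeds (V + bool) K ->
  embeds (T + U) (set K).
Proof.
move=> [f fI] [g gI] VK; apply: embeds_trans (embeds_set VK).
exists (fun s => match s with
  | inl t => inr true |` (inl @` f t) | inr u => inr false |` (inl @` g u) end).
have inlI (A B : set V) (b : bool) :
    inr b |` (inl @` A) = inr b |` (inl @` B) -> A = B.
  move=> /seteqP[AB BA]; apply/seteqP; split=> v Av.
    by have [|//|[w Bw [<-]]] := AB (inl v); first by right; exists v.
  by have [|//|[w Bw [<-]]] := BA (inl v); first by right; exists v.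
have inrI (A B : set V) : inr true |` (inl @` A) <> inr false |` (inl @` B).
  by move=> /seteqP[/(_ (inr true))[|//|[]//]]; left.
move=> [t|u] [t'|u'].
- by move=> /inlI/fI->.
- by move=> /inrI.
- by move=> /esym/inrI.
- by move=> /inlI/gI->.
Qed.

Lemma covers_embeds P Q X (x0 : X) (A : set X) :
  embeds Q P -> covers Q A -> covers P A.
Proof.
move=> [g gI] [f Af].
exists (fun p => match pselect (exists q, g q = p) with
  | left e => f (sval (cid e)) | right _ => x0 end).
move=> x /Af[q _ <-]; exists (g q) => //; case: pselect => [e|[]]; last by exists q.
by congr f; apply: gI; exact: (svalP (cid e)).
Qed.

Lemma covers_subset P X (A B : set X) : A `<=` B -> covers P B -> covers P A.
Proof. by move=> AB [f Bf]; exists f; exact: subset_trans Bf. Qed.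

Section Infinite.
Variables (K : Type) (Kinf : infinite_set [set: K]).

Lemma infinite_inhabited : inhabited K.
Proof. by have [k _] := infinite_setN0 Kinf; exists. Qed.

Lemma embeds_nat : embeds nat K.
Proof. exact/card_le_injP/infiniteP. Qed.

Lemma embeds_square : embeds (K * K) K.
Proof. exact: infinite_pairing. Qed.

Lemma embeds_pair T U : embeds T K -> embeds U K -> embeds (T * U) K.
Proof. by move=> TK UK; apply: embeds_trans embeds_square; exact: embeds_prod. Qed.

Lemma embeds_bool : embeds bool K.
Proof. by apply: embeds_trans embeds_nat; exists nat_of_bool; case; case. Qed.

Lemma embeds_plus T U : embeds T K -> embeds U K -> embeds (T + U) K.
Proof.
move=> [f fI] [g gI]; have [k0] := infinite_inhabited.
apply: embeds_trans (embeds_pair embeds_bool embeds_square).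
exists (fun s => match s with
  | inl t => (true, (f t, k0)) | inr u => (false, (g u, k0)) end).
by move=> [t|u] [t'|u'] // [] => [/fI->|/gI->].
Qed.

(** The length is recorded because folding the pairing function is injective
    only on sequences of a fixed length. *)
Lemma embeds_seq : embeds (seq K) K.
Proof.
have [c cI] := embeds_nat; have [p pI] := embeds_square.
exists (fun s => p (c (size s), foldr (fun x y => p (x, y)) (c 0) s)).
move=> s t /pI[/cI]; elim: s t => [|x s IH] [|y t] //= [st] /pI[-> /(IH _ st)->].
by [].
Qed.

Lemma embeds_powerfun I T :
  embeds I K -> embeds T (set K) -> embeds (I -> T) (set K).
Proof.
move=> IK /embeds_fun TK; apply: embeds_trans (TK I) _; apply: embeds_set.
exact: embeds_pair (embeds_refl K).
Qed.

Lemma embeds_powersum T U :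
  embeds T (set K) -> embeds U (set K) -> embeds (T + U) (set K).
Proof.
move=> TK UK; apply: embeds_sum TK UK _.
by exact: embeds_plus (embeds_refl K) embeds_bool.
Qed.

Lemma embeds_powerpair T U :
  embeds T (set K) -> embeds U (set K) -> embeds (T * U) (set K).
Proof.
move=> TK UK; have : embeds (bool -> T + U) (set K).
  by apply: embeds_powerfun embeds_bool _; exact: embeds_powersum.
apply: embeds_trans; exists (fun p b => if b then inl p.1 else inr p.2).
move=> [t u] [t' u'] tu.
by have [->] := congr1 (@^~ true) tu; have [->] := congr1 (@^~ false) tu.
Qed.

Lemma embeds_point : embeds K (set K).
Proof. by exists (fun k => [set k]) => x y /seteqP[/(_ x)] /(_ erefl). Qed.

End Infinite.

Lemma embeds_option T K : infinite_set [set: K] -> embeds T (set K) ->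
  embeds (option T) (set K).
Proof.
move=> Kinf TK.
have u : embeds unit (set K) by exists (fun=> set0) => -[] [].
apply: embeds_trans (embeds_powersum Kinf TK u).
by exists (fun o => if o is Some t then inl t else inr tt) => -[t|] [t'|] // [->].
Qed.

(** * Closing off a point under operations of bounded arity *)

Inductive tree (P I : Type) := Leaf | Node of P & (I -> tree P I).
Arguments Leaf {P I}.

(** A term is determined by the operation found at each finite address, which
    bounds the number of terms without any use of ordinals. *)
Fixpoint label P I (t : tree P I) (s : seq I) : option P :=
  match t, s with
  | Leaf, _ => None
  | Node p _, [::] => Some p
  | Node _ k, i :: s => label (k i) s
  end.

Lemma label_inj P I : injective (@label P I).
Proof.
elim=> [|p k IH] [|p' k'] // e.
- by have := congr1 (@^~ [::]) e.
- by have := congr1 (@^~ [::]) e.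
- have [->] := congr1 (@^~ [::]) e; congr Node; apply/funext => i; apply: IH.
  by apply/funext => s; have := congr1 (@^~ (i :: s)) e.
Qed.

Lemma embeds_tree K P I : infinite_set [set: K] -> embeds I K -> embeds P (set K) ->
  embeds (tree P I) (set K).
Proof.
move=> Kinf [f fI] PK.
apply: embeds_trans (ex_intro _ (@label P I) (@label_inj P I)) _.
apply: (embeds_powerfun Kinf); last exact: embeds_option.
by apply: embeds_trans (embeds_seq Kinf); exists (map f); exact: inj_map.
Qed.

(** The closure is the set of values of all terms.  With [P] of size 2^kappa
    and [I] of size kappa there are at most 2^kappa terms, since the addresses
    are kappa many. *)
Lemma generated_closure K P I X (phi : P -> (I -> X) -> X) (x0 : X) (Z : set X) :
  infinite_set [set: K] -> embeds I K -> embeds P (set K) ->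
  Z x0 -> (forall p a, range a `<=` Z -> Z (phi p a)) ->
  exists H : set X, [/\ covers (set K) H, H `<=` Z, H x0 &
    forall p a, range a `<=` H -> H (phi p a)].
Proof.
move=> Kinf IK PK Zx0 Zphi.
pose eval := fix eval (t : tree P I) : X :=
  if t is Node p k then phi p (fun i => eval (k i)) else x0.
exists (range eval); split.
- by apply: (covers_embeds x0 (embeds_tree Kinf IK PK)); exists eval.
- move=> _ [t _ <-]; elim: t => [//|p k IH] /=; apply: Zphi => _ [i _ <-]; exact: IH.
- by exists Leaf.
- move=> p a aH.
  have /choice[k kP] : forall i, exists t, eval t = a i.
    by move=> i; have [|t _ <-] := aH (a i); [exists i|exists t].
  by exists (Node p k) => //=; congr phi; apply/funext => i; exact: kP.
Qed.

(** * Well-orders and transfinite recursion *)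

Definition well_ordered W (lt : W -> W -> Prop) : Prop :=
  [/\ well_founded lt, forall x y z, lt x y -> lt y z -> lt x z &
      forall x y, [\/ lt x y, x = y | lt y x]].

Lemma well_ordering T : exists lt : T -> T -> Prop, well_ordered lt.
Proof.
elim/Peq: T => T.
have [R Rwo] := wochoice.well_ordering_principle T.
have RC : wochoice.wo_chain R predT by move=> A _; exact: Rwo.
have Rtot x y : R x y \/ R y x by apply/orP; exact: (wochoice.wo_chainW RC).
have Ranti x y : R x y -> R y x -> x = y.
  by move=> xy yx; apply: (wochoice.wo_chain_antisymmetric RC) => //; rewrite xy.
have Rmin (A : set T) : A !=set0 -> exists2 m, A m & forall x, A x -> R m x.
  move=> [a Aa]; have [|m [[/asboolP Am mP] _]] := Rwo [pred x | `[< A x >]].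
    by exists a; exact/asboolP.
  by exists m => // x Ax; apply: mP; exact/asboolP.
exists (fun x y => R x y /\ x <> y); split.
- move=> x; apply: contrapT => nx.
  have [m nm mP] :=
    Rmin [set x | ~ Acc (fun x y => R x y /\ x <> y) x] (ex_intro _ x nx).
  apply: nm; split=> y [ym yNm]; apply: contrapT => /mP my; exact/yNm/Ranti.
- move=> x y z [xy nxy] [yz nyz]; split; last first.
    by move=> xz; subst; apply: nxy; exact: Ranti.
  have [|m [->|[->|->]] mP] := Rmin [set t | t = x \/ t = y \/ t = z].
  + by exists x; left.
  + by apply: mP; right; right.
  + by case: nxy; apply: Ranti => //; apply: mP; left.
  + by case: nyz; apply: Ranti => //; apply: mP; right; left.
- move=> x y; have [->|xy] := pselect (x = y); first by constructor 2.
  have [h|h] := Rtot x y; first by constructor 1.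
  by constructor 3; split => // /esym.
Qed.

Lemma well_founded_min W (lt : W -> W -> Prop) (A : set W) : well_founded lt ->
  A !=set0 -> exists2 m, A m & forall x, A x -> ~ lt x m.
Proof.
move=> wf [a]; elim/(well_founded_ind wf): a => a IH Aa.
have [[y Ay ya]|h] := pselect (exists2 y, A y & lt y a); first exact: IH ya Ay.
by exists a => // x Ax xa; apply: h; exists x.
Qed.

Lemma well_founded_irr W (lt : W -> W -> Prop) x : well_founded lt -> ~ lt x x.
Proof.
move=> wf; have [|_ -> /(_ x erefl)//] := @well_founded_min _ lt [set x] wf.
by exists x.
Qed.

(** Recursive choice of [f w] subject to a condition [Q] that depends on
    earlier values only, and that can be met whenever it was met before. *)
Lemma transfinite_choice W (lt : W -> W -> Prop) X (x0 : X)
    (Q : (W -> X) -> W -> X -> Prop) : well_founded lt ->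
  (forall f g w y, (forall v, lt v w -> f v = g v) -> Q f w y -> Q g w y) ->
  (forall f w, (forall v, lt v w -> Q f v (f v)) -> exists y, Q f w y) ->
  exists f, forall w, Q f w (f w).
Proof.
move=> wf Qloc Qex.
(* The partial function known at stage [w] is completed by [x0]; by locality
   of [Q] the completion does not matter. *)
pose below w (r : forall v, lt v w -> X) v :=
  if pselect (lt v w) is left h then r v h else x0.
pose pick w f := if pselect (exists y, Q f w y) is left h then sval (cid h) else x0.
pose F := Fix wf (fun=> X) (fun w r => pick w (below w r)).
have FE w : F w = pick w (below w (fun v _ => F v)).
  apply: (Fix_eq wf (fun=> X) (fun w r => pick w (below w r))) => x f g fg.
  by congr pick; apply/funext => v; rewrite /below; case: pselect.
have bF w v : lt v w -> F v = below w (fun v _ => F v) v.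
  by rewrite /below; case: pselect.
exists F => w; elim/(well_founded_ind wf): w => w IH.
have [y Qy] := Qex _ _ IH.
rewrite [X in Q F w X]FE /pick; case: pselect => [h|[]]; last first.
  by exists y; apply: Qloc Qy => v; exact: bF.
by apply: (Qloc _ _ _ _ _ (svalP (cid h))) => v vw; rewrite -bF.
Qed.

Lemma cantor K (h : K -> set K) : ~ [set: set K] `<=` range h.
Proof.
move=> /(_ [set k | ~ h k k] I)[k _ hk].
have : h k k <-> ~ h k k by rewrite [X in X k <-> _]hk.
by tauto.
Qed.

(** A copy of the successor cardinal of [K]: the elements of a well-ordered
    [set K] whose initial segment is enumerated by [K].  If a family indexed by
    [K] were cofinal, then [K], being as large as its square, would enumerate
    all these elements.  That contradicts Cantor's theorem when every segment
    is enumerated; otherwise the least segment that is not enumerated adds one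
    point to them, so it would be enumerated after all. *)
Lemma successor_well_order K : infinite_set [set: K] ->
  exists W (lt : W -> W -> Prop), [/\ well_ordered lt, inhabited W,
    forall w, exists e : K -> W, forall u, lt u w \/ u = w <-> range e u &
    forall g : K -> W, exists v, forall k, lt (g k) v].
Proof.
move=> Kinf; have [k0] := infinite_inhabited Kinf.
have [lt [wf tr tot]] := well_ordering (set K).
pose seg w := [set u | lt u w \/ u = w].
pose good w := covers K (seg w).
pose W := {w | good w}.
pose ltW (u w : W) := lt (sval u) (sval w).
have totW (x y : W) : [\/ ltW x y, x = y | ltW y x].
  case: x y => [x gx] [y gy]; have [xy|xy|yx] := tot x y.
  - by constructor 1.
  - by constructor 2; exact: eq_exist.
  - by constructor 3.
have wfW : well_founded ltW.
  suff h : forall w (gw : good w), Acc ltW (exist _ w gw) by move=> [w gw]; exact: h.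
  move=> w; elim/(well_founded_ind wf): w => w IH gw.
  by split=> -[u gu] uw; exact: IH.
have segW (w : W) : exists e : K -> W, forall u, ltW u w \/ u = w <-> range e u.
  case: w => w gw; have [e se] := gw.
  exists (fun k => match pselect (good (e k) /\ seg w (e k)) with
    | left h => exist _ (e k) h.1 | right _ => exist _ w gw end).
  move=> [u gu]; split.
    move=> uw; have uw' : seg w u by case: uw => [|[]]; [left|right].
    have [k _ ek] := se _ uw'; exists k => //; case: pselect => [h|[]].
      exact: eq_exist.
    by rewrite ek.
  move=> [k _]; case: pselect => [[h [ekw|ekw]] [E]|_ [E]].
  - by left; rewrite /ltW /= -E.
  - by right; apply: eq_exist; rewrite -E.
  - by right; apply: eq_exist.
exists W, ltW; split=> //.
- by split=> // x y z; exact: tr.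
- have [m _ mmin] := well_founded_min wf (ex_intro [set: set K] set0 I).
  have gm : good m by exists (fun=> m) => u [/(mmin u I)//|->]; exists k0.
  by exists; exists m.
move=> g; apply: contrapT => gunb.
have {gunb} gcof v : exists k, ltW v (g k) \/ v = g k.
  apply: contrapT => nv; apply: gunb; exists v => k.
  by have [//|/esym e|h] := totW (g k) v; case: nv; exists k; [right|left].
have {gcof} [h hP] : covers K [set: W].
  have [e eP] := choice segW.
  apply: (covers_embeds (g k0)) (embeds_square Kinf) _.
  exists (fun p => e (g p.1) p.2) => v _.
  by have [k /eP[k' _ <-]] := gcof v; exists (k, k').
have [allgood|/existsNP] := pselect (forall w, good w).
  apply: (@cantor K (fun k => sval (h k))) => w _.
  by have [k _ hk] := hP (exist _ w (allgood w)) I; exists k => //; rewrite hk.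
move=> /(well_founded_min wf)[m nm mmin]; apply: nm.
apply: (covers_embeds m) (embeds_plus Kinf (embeds_refl K) (embeds_bool Kinf)) _.
exists (fun s => if s is inl k then sval (h k) else m) => u [um|->]; last first.
  by exists (inr true).
have gu : good u by apply: contrapT => /mmin.
by have [k _ hk] := hP (exist _ u gu) I; exists (inl k) => //; rewrite hk.
Qed.

(** * Discrete and Lindelof subsets *)

(** Subspaces are handled as sets covered by open sets of the whole space;
    [discrete_in_space] and [lindelof_space_in] connect this with the subspace
    topology. *)
Definition discrete_in (X : topologicalType) (D : set X) : Prop :=
  forall x, D x -> exists O, [/\ open O, O x & forall y, D y -> O y -> y = x].

Definition lindelof_in (X : topologicalType) (L : set X) : Prop :=
  forall U : set (set X), U `<=` open -> L `<=` cover U id ->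
  exists V : set (set X), [/\ V `<=` U, countable V & L `<=` cover V id].

Lemma discrete_in_space (X : topologicalType) (D : set X) :
  discrete_in D -> discrete_space (set_type D).
Proof.
move=> Dd A.
have /choice[O OP] : forall x : D, exists O : set X,
    [/\ open O, O (val x) & forall y, D y -> O y -> y = val x].
  by move=> x; exact: Dd (set_valP x).
exists (\bigcup_(x in A) O x).
  by apply: bigcup_open => x _; have [] := OP x.
apply/seteqP; split=> y /=; last by move=> Ay; exists y => //; have [] := OP y.
move=> [x Ax Oxy]; have [_ _ /(_ _ (set_valP y) Oxy)] := OP x.
by move=> /val_inj ->.
Qed.

Lemma lindelof_space_in (X : topologicalType) (L : set X) :
  lindelof_space (set_type L) -> lindelof_in L.
Proof.
move=> Ll U Uo LU.
pose pre (O : set X) : set (set_type L) := val @^-1` O.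
have [|x _|V' [V'U V'c V'L]] := Ll (pre @` U).
- by move=> _ [O /Uo Oo <-]; exists O.
- by have [O UO Ox] := LU _ (set_valP x); exists (pre O) => //; exists O.
have /choice[r rP] : forall O', exists O, V' O' -> U O /\ pre O = O'.
  move=> O'; have [/V'U[O UO OO']|nV] := pselect (V' O'); first by exists O.
  by exists set0.
exists (r @` V'); split.
- by move=> _ [O' /rP[UO _] <-].
- by apply: sub_countable V'c; exact: card_image_le.
- move=> x Lx; have [O' V'O' O'x] := V'L (exist _ x (mem_set Lx)) I.
  exists (r O'); first by exists O'.
  by have [_ e] := rP _ V'O'; move: O'x; rewrite -{1}e.
Qed.

(** The subcover is a sequence of optional indices because no index need exist
    when [L] is empty. *)
Lemma lindelof_in_family (X : topologicalType) (L : set X) (J : Type)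
    (P : set J) (O : J -> set X) : lindelof_in L ->
  (forall j, P j -> open (O j)) -> (forall x, L x -> exists2 j, P j & O j x) ->
  exists c : nat -> option J, (forall n j, c n = Some j -> P j) /\
    forall x, L x -> exists n j, c n = Some j /\ O j x.
Proof.
move=> Ll Oo LO; have [| |V [VO Vc LV]] := Ll (O @` P).
- by move=> _ [j /Oo ? <-].
- by move=> x /LO[j Pj Ojx]; exists (O j) => //; exists j.
have [f fI] : exists f : set X -> nat, {in V &, injective f} by exact/pcard_injP.
have /choice[c cP] : forall n, exists o : option J,
    if o is Some j then P j /\ exists2 A, V A & f A = n /\ O j = A
    else forall A, V A -> f A <> n.
  move=> n; have [[A VA fA]|nA] := pselect (exists2 A, V A & f A = n).
    by have [j Pj OjA] := VO _ VA; exists (Some j); split => //; exists A.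
  by exists None => A VA fA; apply: nA; exists A.
exists c; split.
  by move=> n j cn; have := cP n; rewrite cn => -[].
move=> x /LV[A VA Ax]; have := cP (f A); case E : (c (f A)) => [j|]; last first.
  by move=> /(_ A VA).
move=> [Pj [A' VA' [fA' OA']]]; exists (f A), j; split => //.
by rewrite OA'; suff -> : A' = A by []; apply: fI => //; exact/mem_set.
Qed.

Lemma lindelof_in_closedI (X : topologicalType) (L C : set X) :
  lindelof_in L -> closed C -> lindelof_in (L `&` C).
Proof.
move=> Ll Cc U Uo LU; have [| |V [VU Vc LV]] := Ll (~` C |` U).
- by move=> _ [->|/Uo//]; exact: closed_openC.
- move=> x Lx; have [Cx|nCx] := pselect (C x).
    by have [O UO Ox] := LU x (conj Lx Cx); exists O => //; right.
  by exists (~` C) => //; left.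
exists (V `\ (~` C)); split.
- by move=> O [/VU[-> []|]].
- by apply: sub_countable Vc; exact: card_le_setD.
- move=> x [Lx Cx]; have [O VO Ox] := LV x Lx; exists O => //; split=> // OC.
  by move: Ox; rewrite OC.
Qed.

(** * The closing-off lemma *)

(** [b x] is a base of open neighbourhoods at [x] indexed by [K]: the character
    is at most the cardinal of [K]. *)
Section Base.
Variables (X : topologicalType) (K : Type) (Kinf : infinite_set [set: K]).
Variable b : X -> K -> set X.
Hypothesis b_open : forall x k, open_nbhs x (b x k).
Hypothesis b_base : forall x U, nbhs x U -> exists k, b x k `<=` U.

Lemma closure_base (A : set X) q : (forall k, A `&` b q k !=set0) -> closure A q.
Proof.
by move=> Aq U /b_base[k bU]; have [x [Ax /bU Ux]] := Aq k; exists x.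
Qed.

(** The exceptional set [S] is the closure of [A] when [Y] is Lindelof; in a
    Urysohn space it has to be larger, the theta-closure of that closure. *)
Definition separates (Y A : set X) : Prop :=
  exists (S : set X) (O : set K -> set X), [/\ covers (set K) S,
    forall s, open (O s), forall s, Y `&` closure A `<=` O s &
    forall p, Y p -> ~ S p -> exists s, ~ O s p].

(** The bound on [Y] is reached by showing that [Y] is contained in the set [H]
    closed under [phi]; a point [p] outside [H] yields a sequence of length the
    successor of kappa that cannot lie in a Lindelof set. *)
Theorem closing_off (Y : set X) (y0 : X) : Y y0 ->
  (forall D, D `<=` Y -> discrete_in D ->
    exists L, [/\ lindelof_in L, D `<=` L & L `<=` Y]) ->
  (forall a : K -> X, range a `<=` Y -> separates Y (range a)) ->
  covers (set K) Y.
Proof.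
move=> Yy0 HL HO; have [k0] := infinite_inhabited Kinf.
have /choice[fS /choice[O fSO]] : forall a : K -> X, exists f : set K -> X,
    exists O : set K -> set X, range a `<=` Y -> [/\ forall s, open (O s),
    forall s, Y `&` closure (range a) `<=` O s &
    forall p, Y p -> ~ range f p -> exists s, ~ O s p].
  move=> a; have [/HO[S [O [[f Sf] Oo OY Op]]]|na] := pselect (range a `<=` Y).
    exists f, O => _; split => // p Yp fp; apply: Op => // Sp; apply: fp; exact: Sf.
  by exists (fun=> y0), (fun=> setT).
(* The operations on [Y]: the exceptional points of an enumerated set (the
   second coordinate of the arity enumerates it), and a point outside the union
   of the open sets numbered [s k] for the sets enumerated by [a (k, _)]. *)
pose phi (s : set K + (K -> set K)) (a : K * K -> X) : X := match s with
  | inl s => let z := fS (fun k => a (k0, k)) s in if pselect (Y z) then z else y0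
  | inr s => if pselect (exists y, Y y /\ forall k, ~ O (fun j => a (k, j)) (s k) y)
             is left h then sval (cid h) else y0
  end.
have PK : embeds (set K + (K -> set K)) (set K).
  apply: embeds_powersum => //; first exact: embeds_refl.
  by apply: embeds_powerfun => //; exact: embeds_refl.
have phiY s a : range a `<=` Y -> Y (phi s a).
  move=> _; case: s => s /=; case: pselect => // h.
  by have [] := svalP (cid h).
have [H [Hsmall HY Hy0 Hphi]] :=
  generated_closure Kinf (embeds_square Kinf) PK Yy0 phiY.
apply: covers_subset Hsmall => p Yp; apply: contrapT => nHp.
(* [p] is exceptional for no subset of [H], as those points are in [H]; so
   some open set around the closure misses it. *)
have /choice[sg sgP] : forall a : K -> X, exists s, range a `<=` H -> ~ O a s p.
  move=> a; have [aH|] := pselect (range a `<=` H); last by exists set0.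
  have [_ _ /(_ p Yp)[[s _ fsp]|s nO]] := fSO a (subset_trans aH HY).
    case: nHp; rewrite -fsp.
    have := Hphi (inl s) (fun jk => a jk.2); rewrite /phi /=; case: pselect => [Yz h|].
      by apply: h => _ [jk _ <-]; apply: aH; exists jk.2.
    by rewrite fsp.
  by exists s.
pose G a := O a (sg a).
have escape (a : K -> K -> X) : (forall k, range (a k) `<=` H) ->
    exists2 y, H y & forall k, ~ G (a k) y.
  move=> aH; have := Hphi (inr (fun k => sg (a k))) (fun kj => a kj.1 kj.2).
  rewrite /phi /=; case: pselect => [h|[]]; last first.
    by exists p; split => // k; exact: sgP.
  move=> Hh; exists (sval (cid h)); last by have [] := svalP (cid h).
  by apply: Hh => _ [[k j] _ <-]; apply: (aH k); exists j.
have GP a : range a `<=` H -> open (G a) /\ Y `&` closure (range a) `<=` G a.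
  move=> aH; have [Oo OY _] := fSO a (subset_trans aH HY).
  by split; [exact: Oo|exact: OY].
have [W [lt [[wf tr tot] [w0] /choice[e eP] Wunb]]] := successor_well_order Kinf.
have e_le w k : lt (e w k) w \/ e w k = w by apply/eP; exists k.
(* [init f w] enumerates the values of [f] strictly below [w]; [y0] stands in
   for the value at [w] itself. *)
pose init f w k := if pselect (e w k = w) then y0 else f (e w k).
have [x xP] : exists x : W -> X, forall w,
    H (x w) /\ forall u, lt u w \/ u = w -> ~ G (init x u) (x w).
  apply: (transfinite_choice y0 (Q := fun f w y =>
    H y /\ forall u, lt u w \/ u = w -> ~ G (init f u) y) wf).
    move=> f g w y fg [Hy fy]; split => // u uw.
    suff <- : init f u = init g u by exact: fy.
    apply/funext => k; rewrite /init; case: pselect => // euk.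
    apply: fg; case: (e_le u k) => // eu.
    by case: uw => [uw|<-//]; exact: tr uw.
  move=> f w IH; have [|y Hy yG] := escape (fun k => init f (e w k)).
    move=> k _ [j _ <-]; rewrite /init; case: pselect => // ne.
    apply: (IH _ _).1; case: (e_le (e w k) j) => // eu.
    by case: (e_le w k) => [uw|ek]; [exact: tr uw|move: eu; rewrite ek].
  by exists y; split => // u /eP[k _ <-]; exact: yG.
have xH w : H (x w) := (xP w).1.
have initH w : range (init x w) `<=` H.
  by move=> _ [k _ <-]; rewrite /init; case: pselect => //= _; exact: xH.
have init_lt v w : lt v w -> range (init x w) (x v).
  move=> vw; have /eP[k _ ek] : lt v w \/ v = w by left.
  exists k => //; rewrite /init; case: pselect => [ew|_ /=]; last by rewrite ek.
  by case: (well_founded_irr wf (x := w)); rewrite -{1}ew ek.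
have Gopen w : open (G (init x w)) := (GP _ (initH w)).1.
have Gcl w q : Y q -> closure (range (init x w)) q -> G (init x w) q.
  by move=> Yq cq; apply: (GP _ (initH w)).2.
have Glt v w : lt v w -> G (init x w) (x v).
  by move=> vw; apply: Gcl; [exact: HY|apply: subset_closure; exact: init_lt].
have Gge v w : lt v w \/ v = w -> ~ G (init x v) (x w) by exact: (xP w).2.
have [||L [Ll DL LY]] := HL (range x).
- by move=> _ [w _ <-]; exact: HY.
(* With [w'] the successor of [w], the set [G (init x w')] contains [x w] and no
   later term; earlier terms are in the closure removed. *)
- move=> _ [w _ <-].
  have [w' ww' w'min] : exists2 w', lt w w' & forall u, lt w u -> ~ lt u w'.
    apply: (well_founded_min (A := lt w)) => //.
    by have [v vP] := Wunb (fun=> w); exists v; exact: vP k0.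
  exists (G (init x w') `&` ~` closure (range (init x w))); split.
  + by apply: openI => //; apply: closed_openC; exact: closed_closure.
  + by split; [exact: Glt|move=> /Gcl h; apply: (Gge w w); [right|apply: h; exact: HY]].
  + move=> _ [u _ <-] [Gu cu].
    have [uw|->//|wu] := tot u w.
      by case: cu; apply: subset_closure; exact: init_lt.
    case: (Gge w' u) => //; have [uw'|->|w'u] := tot u w'; [|by right|by left].
    by case: (w'min u).
pose F (j : option W) := if j is Some w then G (init x w) else ~` closure (range x).
have [||c [_ cP]] := @lindelof_in_family _ _ _ setT F Ll.
- by move=> [w|] _ //=; apply: closed_openC; exact: closed_closure.
(* A point in the closure of the whole sequence meets one term in each of its
   kappa many basic neighbourhoods; these terms lie below some [v]. *)
- move=> q Lq; have [cq|] := pselect (closure (range x) q); last by exists None.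
  have /choice[g gP] : forall k, exists w, b q k (x w).
    move=> k; have [|_ [[w _ <-] bw]] := cq (b q k); last by exists w.
    exact: open_nbhs_nbhs.
  have [v vP] := Wunb g; exists (Some v) => //=; apply: Gcl; first exact: LY.
  by apply: closure_base => k; exists (x (g k)); split => //; exact: init_lt.
(* The countable subcover involves at most kappa many indices, so some [v] lies
   above all of them; its term [x v] is then not covered. *)
have [h hP] : covers K [set: nat].
  by apply: (covers_embeds 0 (embeds_nat Kinf)); exists id => n; exists n.
have [v vP] := Wunb (fun k => if c (h k) is Some (Some w) then w else w0).
have [|n [j [cn]]] := cP (x v); first by apply: DL; exists v.
have [k _ hk] := hP n I; have := vP k; rewrite hk cn.
case: j {cn} => [w|_] /=; last by apply; apply: subset_closure; exists v.
by move=> wv; apply: Gge; left.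
Qed.

(** * Theta-closures and Lindelof subspaces *)

Definition theta_closure (A : set X) : set X :=
  [set x | forall U, nbhs x U -> closure U `&` A !=set0].

Lemma closure_theta A : closure A `<=` theta_closure A.
Proof.
move=> x xA U /xA[y [Ay Uy]]; exists y; split => //; exact: subset_closure.
Qed.

(** A point [q] of the theta-closure is coded by points of [A], one in each
    intersection of the closures of [b q i] and [b q j].  Two points with the
    same code would have no neighbourhoods with disjoint closures. *)
Lemma theta_closure_covers (A : set X) (x0 : X) : urysohn_space X ->
  covers (set K) A -> covers (set K) (theta_closure A).
Proof.
move=> UX [f Af].
pose P (s : K * K -> set K) q := forall i j,
  (closure (b q i) `&` closure (b q j)) (f (s (i, j))).
have Puniq s q q' : P s q -> P s q' -> q = q'.
  move=> Pq Pq'; apply: contrapT => /UX[U [V [[Uo Uq] [Vo Vq'] UV]]].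
  have [i iU] := b_base (open_nbhs_nbhs (conj Uo Uq)).
  have [j jV] := b_base (open_nbhs_nbhs (conj Vo Vq')).
  suff : (closure U `&` closure V) (f (s (i, j))) by rewrite UV.
  split; first by have [+ _] := Pq i j; apply: closureS.
  by have [_ +] := Pq' i j; apply: closureS.
have code : embeds (K * K -> set K) (set K).
  by apply: embeds_powerfun (embeds_square Kinf) (embeds_refl _).
apply: (covers_embeds x0 code).
exists (fun s => if pselect (exists q, P s q) is left h then sval (cid h) else x0).
move=> q qA.
have /choice[s sP] : forall ij : K * K, exists s,
    (closure (b q ij.1) `&` closure (b q ij.2)) (f s).
  move=> [i j].
  have [|x [bx Ax]] := qA (b q i `&` b q j).
    by apply: filterI; exact/open_nbhs_nbhs/b_open.
  have [s _ fs] := Af _ Ax; exists s; rewrite fs /=.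
  by have [bi bj] := closureI bx.
have Psq : P s q by move=> i j; exact: sP (i, j).
exists s => //; case: pselect => [h|[]]; last by exists q.
by apply: (Puniq s) => //; exact: svalP (cid h).
Qed.

(** Arhangel'skii's bound for Lindelof spaces.  The closure [C] of a set of size
    kappa meets [L] in a Lindelof set; hence countable unions of basic open sets
    around points of [C], of which there are 2^kappa, separate it from every
    other point of [L]. *)
Lemma lindelof_covers (L : set X) : accessible_space X -> urysohn_space X ->
  lindelof_in L -> L !=set0 -> covers (set K) L.
Proof.
move=> T1 UX Ll [y0 Ly0].
apply: (closing_off Ly0).
  by move=> D DL _; exists L; split.
move=> a aL; set C := closure (range a).
have [fC CfC] : covers (set K) C.
  apply: covers_subset (@closure_theta _) _; apply: theta_closure_covers => //.
  by apply: (covers_embeds y0 (embeds_point K)); exists a.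
have codeP : embeds (nat -> option (set K * K)) (set K).
  apply: embeds_powerfun (embeds_nat Kinf) _ => //; apply: embeds_option => //.
  by apply: embeds_powerpair => //; [exact: embeds_refl|exact: embeds_point].
pose O (c : nat -> option (set K * K)) : set X :=
  \bigcup_n (if c n is Some j then b (fC j.1) j.2 else set0).
have Oo c : open (O c).
  apply: bigcup_open => n _; case: (c n) => [j|]; last exact: open0.
  exact: (b_open _ _).1.
(* Of all countable unions, only those containing [L `&` C] are kept; [setT]
   replaces the others. *)
have [D [DO DP]] : exists D : set K -> set X,
    (forall s, open (D s) /\ L `&` C `<=` D s) /\
    forall c, L `&` C `<=` O c -> exists s, D s = O c.
  have [g gI] := codeP.
  exists (fun s => if pselect (exists c, g c = s /\ L `&` C `<=` O c) is left h
    then O (sval (cid h)) else setT).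
  split.
    move=> s; case: pselect => [h|_]; last by split; [exact: openT|].
    by have [_ h2] := svalP (cid h); split.
  move=> c LC; exists (g c); case: pselect => [h|[]]; last by exists c.
  by have [h1 _] := svalP (cid h); rewrite (gI _ _ h1).
exists C, D; split.
- by exists fC.
- by move=> s; have [] := DO s.
- by move=> s; have [] := DO s.
move=> p Lp nCp.
have LCl : lindelof_in (L `&` C).
  by apply: lindelof_in_closedI Ll _; exact: closed_closure.
have [||c [cp cO]] := @lindelof_in_family _ _ _ [set j | ~ b (fC j.1) j.2 p]
    (fun j : set K * K => b (fC j.1) j.2) LCl.
- by move=> j _; exact: (b_open _ _).1.
- move=> q [Lq Cq]; have [s _ fs] := CfC _ Cq.
  have qp : q != p by apply/eqP => qp; apply: nCp; rewrite -qp.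
  have [U [Uo /set_mem Uq /set_mem nUp]] := T1 _ _ qp.
  have [k kU] := b_base (open_nbhs_nbhs (conj Uo Uq)).
  by exists (s, k); rewrite /= fs; [move=> /kU|exact: (b_open _ _).2].
have [|s Ds] := DP c.
  by move=> q /cO[n [j [cn bq]]]; exists n => //; rewrite cn.
by exists s; rewrite Ds => -[n _]; case E : (c n) => [j|] //; exact: cp E.
Qed.

(** * The bound for almost discretely Lindelof spaces *)

(** Shapirovskii's lemma.  Going through a well-ordering of the space, a point
    is put into [E] when it is outside [S] and not yet covered by the closure of
    the earlier points of [E] and their neighbourhoods [B].  A point [x] of [E]
    is isolated in [E]: [B x] has no later point, and [x] is not in the closure
    of the earlier ones. *)
Lemma discrete_cover (S : set X) (B : X -> set X) : (forall y, open_nbhs y (B y)) ->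
  exists E, [/\ discrete_in E, E `<=` ~` S &
    ~` S `<=` closure E `|` \bigcup_(y in E) B y].
Proof.
move=> BP; have [lt [wf tr tot]] := well_ordering X.
have [||E EP] := @transfinite_choice _ lt Prop True (fun f w P =>
  P = [/\ ~ S w, ~ closure [set v | lt v w /\ f v] w &
    forall v, lt v w -> f v -> ~ B v w]) wf.
- move=> f g w P fg ->; apply/propext.
  suff -> : [set v | lt v w /\ f v] = [set v | lt v w /\ g v].
    by split=> -[? ? h]; split => // v vw; [rewrite -fg//|rewrite fg//]; exact: h.
  by apply/seteqP; split=> v [vw]; [rewrite fg|rewrite -fg].
- by move=> f w _; eexists; reflexivity.
exists E; split.
- move=> x Ex; have := Ex; rewrite EP => -[_ ncl nB].
  exists (B x `&` ~` closure [set v | lt v x /\ E v]); split.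
  + by apply: openI; [exact: (BP x).1|apply: closed_openC; exact: closed_closure].
  + by split => //; exact: (BP x).2.
  + move=> y Ey [By cy]; have [yx|//|xy] := tot y x.
      by case: cy; exact: subset_closure.
    by have := Ey; rewrite EP => -[_ _ /(_ x xy Ex)].
- by move=> x; rewrite EP => -[].
- move=> p nSp; apply: contrapT => np; apply: np.
  have [Ep|] := pselect (E p); first by left; exact: subset_closure.
  move=> nEp; apply: contrapT => np; apply: nEp; rewrite EP; split => //.
    by move=> cp; apply: np; left; apply: closureS cp => v [].
  by move=> v _ Ev Bv; apply: np; right; exists v.
Qed.

(** Discrete sets have size at most 2^kappa, being contained in Lindelof sets.
    So the family of open sets produced by [discrete_cover] around the closure
    of a set of size kappa has at most 2^kappa members. *)
Theorem cardinality_bound : accessible_space X -> urysohn_space X ->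
  almost_discretely_lindelof X -> X -> covers (set K) [set: X].
Proof.
move=> T1 UX adl x0.
have HL (D : set X) : discrete_in D -> exists2 L, lindelof_in L & D `<=` L.
  move=> Dd; have [L [Ll DL]] := adl _ (discrete_in_space Dd).
  by exists L => //; exact: lindelof_space_in.
have small (D : set X) : discrete_in D -> covers (set K) D.
  move=> /HL[L Ll DL]; apply: covers_subset DL _.
  have [L0|nL] := pselect (L !=set0); first exact: lindelof_covers.
  by exists (fun=> x0) => x Lx; case: nL; exists x.
apply: (closing_off (y0 := x0)) => //.
  by move=> D _ /HL[L Ll DL]; exists L.
move=> a _; set C := closure (range a); pose S := theta_closure C.
have Cs : covers (set K) C.
  apply: covers_subset (@closure_theta _) _; apply: theta_closure_covers => //.
  by apply: (covers_embeds x0 (embeds_point K)); exists a.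
have /choice[B BP] : forall y, exists B,
    open_nbhs y B /\ (~ S y -> closure B `&` C = set0).
  move=> y; have [Sy|/existsNP[U]] := pselect (S y).
    by exists setT; split => //; split => //; exact: openT.
  move=> /not_implyP[Uy UC]; have [k kU] := b_base Uy; exists (b y k); split => // _.
  rewrite -subset0 => z [bz Cz]; apply: UC; exists z; split => //.
  exact: closureS kU z bz.
have [E [Ed ES Ecov]] := discrete_cover S (fun y => (BP y).1).
have [f fE] : covers (set K) (closure E).
  apply: covers_subset (@closure_theta _) _; apply: theta_closure_covers => //.
  exact: small.
exists S, (fun s => if pselect (S (f s)) then setT else ~` closure (B (f s))); split.
- exact: theta_closure_covers.
- move=> s; case: pselect => _ /=; first exact: openT.
  by apply: closed_openC; exact: closed_closure.
- move=> s q [_ Cq]; case: pselect => //= nS Bq.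
  have /seteqP[BC _] := (BP (f s)).2 nS; exact: (BC q).
- move=> p _ nSp.
  have [y [cy nSy By]] : exists y, [/\ closure E y, ~ S y & B y p].
    have [cp|[y Ey By]] := Ecov p nSp.
      by exists p; split => //; exact: (BP p).1.2.
    by exists y; split => //; [exact: subset_closure|exact: ES].
  have [s _ fs] := fE _ cy; exists s; case: pselect => /=; rewrite fs //.
  by move=> _; apply; exact: subset_closure.
Qed.

End Base.

Theorem corollary7 (X : topologicalType)
    (T1X : accessible_space X)
    (urysohnX : urysohn_space X)
    (adlX : almost_discretely_lindelof X) :
  ([set: X] #<= [set: set (character X)])%card.
Proof.
have [[Kinf Kbase] _] := characterP X.
have [X0|] := pselect (exists x : X, True); last first.
  move=> nX; have -> : [set: X] = set0 by rewrite -subset0 => x; case: nX; exists x.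
  exact: card_ge0.
case: X0 => x0 _.
have /choice[b bP] : forall x : X, exists b : character X -> set X,
    (forall k, open_nbhs x (b k)) /\ forall U, nbhs x U -> exists k, b k `<=` U.
  move=> x; have [B [Bx Bbase] /pcard_surjP[g gB]] := Kbase x.
  exists (fun k => if pselect (B (g k)) then (g k)° else setT); split.
    move=> k; case: pselect => [Bk|_] /=; last by split; [exact: openT|].
    by split; [exact: open_interior|exact: Bx].
  move=> U /Bbase[V BV VU]; have [k _ gk] := gB V BV; exists k.
  case: pselect => /=; last by rewrite gk.
  by move=> _; rewrite gk; apply: subset_trans VU; exact: interior_subset.
have [f fX] := cardinality_bound Kinf (fun x => (bP x).1)
  (fun x => (bP x).2) T1X urysohnX adlX x0.
apply: card_le_trans (subset_card_le fX) (card_image_le _ _).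
Qed.
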